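(* There are absolute constants $c_1,c_2>0$ such that for every integer $n'$ there exist an integer $n\ge n'$ and a set $X$ of $n$ points in the plane that is a permutation, such that $\mathrm{opt}(X)\ge c_1\, n\log\log n$ but $\mathrm{WB}(X)\le c_2\, n\log\log\log n$. In other words, for every ordering $\sigma$ of $\mathcal L(X)$ (equivalently every partitioning tree), $\mathrm{opt}(X)/\mathrm{WB}_\sigma(X)\ge \Omega\!\left(\frac{\log\log n}{\log\log\log n}\right)$.
   Context: Points have integer coordinates. Two points $p,q$ are collinear if $p.x=q.x$ or $p.y=q.y$; otherwise $\square_{p,q}$ is the smallest closed axis-parallel rectangle containing $p$ and $q$. A non-collinear pair $(p,q)$ is satisfied in a point set $S$ if some point $r\in S\setminus\{p,q\}$ lies in $\square_{p,q}$; $S$ is satisfied if every non-collinear pair of its points is satisfied in $S$. A row (column) is a horizontal (vertical) line; it is active for $X$ if it contains a point of $X$. $X$ is a semi-permutation if every active row contains exactly one point of $X$, and a permutation if moreover every active column contains exactly one point of $X$. For a finite semi-permutation $X$, $\mathrm{opt}(X)$ is the minimum of $|Y|$ over all point sets $Y$ with $X\cup Y$ satisfied (the Min-Sat problem; this equals, up to a constant factor, the optimal cost of a binary search tree execution on the access sequence encoded by $X$, where a point $(x,t)$ means key $x$ is accessed at time $t$). Strong Wilber bound: let $B$ be the bounding box of $X$ and $\mathcal L(X)$ the set of vertical lines with half-integral $x$-coordinate strictly between the minimum and maximum $x$-coordinates of $X$. For an ordering $\sigma$ of $\mathcal L(X)$, start with the partition $\{B\}$ and process the lines in order; each line $L$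 splits the unique current vertical strip $S$ containing it into two strips, and is charged $\mathrm{cost}(L)=$ the number of indices $j$ such that $q_j,q_{j+1}$ lie on opposite sides of $L$, where $q_1,\dots,q_z$ are the points of $X\cap S$ in increasing order of $y$-coordinate. $\mathrm{WB}_\sigma(X)=\sum_L \mathrm{cost}(L)$ and $\mathrm{WB}(X)=\max_\sigma \mathrm{WB}_\sigma(X)$. *)

(* Defs.v *)
From Stdlib Require Import ZArith List Reals Bool.
Open Scope bool_scope.
Import ListNotations.
Open Scope Z_scope.

Definition point : Type := (Z * Z)%type.

Definition collinear (p q : point) : Prop := fst p = fst q \/ snd p = snd q.

Definition in_box (p q r : point) : Prop :=
  Z.min (fst p) (fst q) <= fst r <= Z.max (fst p) (fst q) /\
  Z.min (snd p) (snd q) <= snd r <= Z.max (snd p) (snd q).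

Definition pair_satisfied (S : list point) (p q : point) : Prop :=
  exists r, In r S /\ r <> p /\ r <> q /\ in_box p q r.

Definition satisfied (S : list point) : Prop :=
  forall p q, In p S -> In q S -> ~ collinear p q -> pair_satisfied S p q.

Definition semi_permutation (X : list point) : Prop :=
  forall p q, In p X -> In q X -> snd p = snd q -> p = q.

Definition is_permutation (X : list point) : Prop :=
  semi_permutation X /\ (forall p q, In p X -> In q X -> fst p = fst q -> p = q).

Definition opt_at_least (X : list point) (k : R) : Prop :=
  forall Y : list point, NoDup Y -> satisfied (X ++ Y) -> (k <= INR (length Y))%R.

(* The vertical line x = k + 1/2 is represented by the integer k.
   It belongs to L(X) iff min x(X) <= k < max x(X). *)
Definition in_lines (X : list point) (k : Z) : Prop :=
  exists p q, In p X /\ In q X /\ fst p <= k < fst q.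

Definition is_ordering (X : list point) (sigma : list Z) : Prop :=
  NoDup sigma /\ forall k, In k sigma <-> in_lines X k.

Definition side (k : Z) (p : point) : bool := (fst p <=? k).

(* p lies in the current strip containing line k, the already processed
   lines being P: p is on the same side as line k of every line in P. *)
Definition in_strip (P : list Z) (k : Z) (p : point) : bool :=
  forallb (fun j => implb (j <? k) (j <? fst p) && implb (k <? j) (fst p <=? j)) P.

Definition strip (X : list point) (P : list Z) (k : Z) : list point :=
  filter (in_strip P k) X.

Definition consecutive (S : list point) (p q : point) : bool :=
  (snd p <? snd q) &&
  negb (existsb (fun r => (snd p <? snd r) && (snd r <? snd q)) S).

Definition cost (X : list point) (P : list Z) (k : Z) : nat :=
  let S := strip X P k in
  length (filter (fun pq => consecutive S (fst pq) (snd pq)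
                            && xorb (side k (fst pq)) (side k (snd pq)))
                 (list_prod S S)).

Fixpoint WB_aux (X : list point) (P : list Z) (sigma : list Z) : nat :=
  match sigma with
  | [] => 0%nat
  | k :: s => (cost X P k + WB_aux X (k :: P) s)%nat
  end.

Definition WB_sigma (X : list point) (sigma : list Z) : nat := WB_aux X [] sigma.

(* Main.v *)
(* With m = 2^l, the set consists of 2^m bit-reversal sequences of length m stacked
   on top of each other, the r-th one using the columns r + 2^i for i < m, suitably
   refined so that no column is used twice.

   Each sequence alone costs of order m l: every satisfied superset has, in each strip
   of the balanced binary subdivision of the exponents i, linearly many rows meeting
   both halves of the strip.

   On the other hand WB is linear in the number n = m 2^m of points, which is even
   better than n log log log n.  Split a strip of width w into parts of widths w1 and
   w2, and let u = min(w1, w2).  For exponents with 2^i > 2w the shifts r that put a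
   point into the strip form disjoint intervals, on which the points move from left to
   right, so these exponents cause O(m) crossings.  For the other exponents, apart
   from points on the side that dominates anyway, only O(min(u, 2^i)) shifts matter.
   The sum of min(u, 2^i) over 2^i < 2w telescopes along any partitioning tree against
   the potential sum_i max(0, 4w - 2^i), whose value at the root is O(n). *)
Require Import Defs.
From Stdlib Require Import ZArith List Reals Lra Lia Bool FinFun.
Import ListNotations.
Open Scope Z_scope.

(** * Counting in intervals and lists *)

Lemma length_le_interval (l : list Z) (lo hi : Z) :
  NoDup l -> (forall z, In z l -> lo <= z < hi) -> lo <= hi ->
  Z.of_nat (length l) <= hi - lo.
Proof.
  intros Hnd Hl Hle.
  assert (H : (length l <= length (map (fun i => (lo + Z.of_nat i)%Z) (seq 0 (Z.to_nat (hi - lo)))))%nat).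
  { apply NoDup_incl_length; [exact Hnd|].
    intros z Hz. apply Hl in Hz. apply in_map_iff.
    exists (Z.to_nat (z - lo)). split; [lia|]. apply in_seq. lia. }
  rewrite length_map, length_seq in H. lia.
Qed.

Lemma multiples_in_interval (l : list nat) (m lo len : Z) :
  0 < m -> 0 <= len -> NoDup l ->
  (forall r, In r l -> lo <= m * Z.of_nat r < lo + len) ->
  m * Z.of_nat (length l) <= len + m.
Proof.
  intros Hm Hlen Hnd Hl.
  pose proof (Z.div_mod (- lo) m ltac:(lia)).
  pose proof (Z.mod_pos_bound (- lo) m Hm).
  pose proof (Z.div_mod (lo + len - 1) m ltac:(lia)).
  pose proof (Z.mod_pos_bound (lo + len - 1) m Hm).
  (* [- d1] is the ceiling of [lo / m], so the admissible [r] run from [- d1] to [d2]. *)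
  set (d1 := (- lo) / m) in *. set (d2 := (lo + len - 1) / m) in *.
  assert (Hc : Z.of_nat (length (map Z.of_nat l)) <= (d2 + 1) - (- d1)).
  { apply length_le_interval.
    - apply Injective_map_NoDup; [intros x y; apply Nat2Z.inj|exact Hnd].
    - intros z Hz. apply in_map_iff in Hz. destruct Hz as [r [<- Hr]].
      apply Hl in Hr. nia.
    - nia. }
  rewrite length_map in Hc. nia.
Qed.

Lemma length_filter_orb {A : Type} (f g h : A -> bool) (l : list A) :
  (forall x, In x l -> f x = true -> g x = true \/ h x = true) ->
  (length (filter f l) <= length (filter g l) + length (filter h l))%nat.
Proof.
  induction l as [|x l IH]; intros H; simpl; [lia|].
  specialize (IH (fun y Hy => H y (or_intror Hy))).
  pose proof (H x (or_introl eq_refl)) as Hx.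
  destruct (f x), (g x), (h x); simpl; lia.
Qed.

Definition zsum (f : nat -> Z) (l : list nat) : Z :=
  fold_right (fun t s => f t + s) 0 l.

Lemma zsum_le (f g : nat -> Z) (l : list nat) :
  (forall t, In t l -> f t <= g t) -> zsum f l <= zsum g l.
Proof.
  induction l as [|t l IH]; intros H; simpl; [lia|].
  pose proof (H t (or_introl eq_refl)).
  specialize (IH (fun u Hu => H u (or_intror Hu))). lia.
Qed.

Lemma zsum_nonneg (f : nat -> Z) (l : list nat) :
  (forall t, 0 <= f t) -> 0 <= zsum f l.
Proof.
  intros H. induction l as [|t l IH]; simpl; [lia|]. specialize (H t). lia.
Qed.

Lemma zsum_affine (f : nat -> Z) (a c : Z) (l : list nat) :
  zsum (fun t => a * f t + c) l = a * zsum f l + c * Z.of_nat (length l).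
Proof.
  unfold zsum. induction l as [|t l IH]; [simpl; lia|].
  cbn [fold_right length]. rewrite IH, Nat2Z.inj_succ. ring.
Qed.

Lemma length_filter_list_prod (f : nat * nat -> bool) (g : nat -> Z) (m : Z)
    (A B : list nat) :
  (forall t, In t A ->
     m * Z.of_nat (length (filter (fun r => f (t, r)) B)) <= g t) ->
  m * Z.of_nat (length (filter f (list_prod A B))) <= zsum g A.
Proof.
  induction A as [|t A IH]; intros H; simpl; [lia|].
  specialize (IH (fun u Hu => H u (or_intror Hu))).
  pose proof (H t (or_introl eq_refl)) as Ht.
  rewrite filter_app, length_app.
  replace (length (filter f (map (fun r => (t, r)) B)))
    with (length (filter (fun r => f (t, r)) B)); [lia|].
  clear. induction B as [|r B IH]; simpl; [reflexivity|].
  destruct (f (t, r)); simpl; lia.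
Qed.

Lemma NoDup_list_prod {A B : Type} (l : list A) (l' : list B) :
  NoDup l -> NoDup l' -> NoDup (list_prod l l').
Proof.
  intros Hl Hl'. induction Hl as [|x l Hx Hl IH]; simpl; [constructor|].
  apply NoDup_app.
  - apply Injective_map_NoDup; [congruence|exact Hl'].
  - exact IH.
  - intros [a b] H1 H2. apply in_map_iff in H1. destruct H1 as [y [E _]].
    apply in_prod_iff in H2. injection E as -> ->. tauto.
Qed.

(** * Crossings of a line and phases *)

(** The body of [cost] as a function of the strip alone: [cost X P k] is convertible to
    [crossings (strip X P k) k]. *)
Definition crossings (S : list point) (k : Z) : nat :=
  length (filter (fun pq => consecutive S (fst pq) (snd pq)
                            && xorb (side k (fst pq)) (side k (snd pq)))
                 (list_prod S S)).

Lemma consecutive_spec (S : list point) (p q : point) :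
  consecutive S p q = true ->
  snd p < snd q /\ forall r, In r S -> snd r <= snd p \/ snd q <= snd r.
Proof.
  unfold consecutive. intros H. apply andb_true_iff in H. destruct H as [H1 H2].
  apply Z.ltb_lt in H1. split; [exact H1|]. intros r Hr.
  apply negb_true_iff in H2.
  destruct (Z_le_gt_dec (snd r) (snd p)); [now left|].
  destruct (Z_le_gt_dec (snd q) (snd r)); [now right|].
  exfalso. assert (E : existsb (fun r => (snd p <? snd r) && (snd r <? snd q)) S = true).
  { apply existsb_exists. exists r. split; [exact Hr|].
    apply andb_true_iff. rewrite !Z.ltb_lt. lia. }
  congruence.
Qed.

(* A crossing pair either has an endpoint in [D] or raises the phase. *)
Lemma crossings_le (S : list point) (k : Z) (D : point -> bool) (ph : point -> Z)
    (K : Z) :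
  NoDup S ->
  (forall p q, In p S -> In q S -> snd p = snd q -> p = q) ->
  0 <= K ->
  (forall p, In p S -> D p = false -> 0 <= ph p <= K) ->
  (forall p q, In p S -> In q S -> D p = false -> D q = false ->
     snd p < snd q -> ph p <= ph q) ->
  (forall p q, In p S -> In q S -> D p = false -> D q = false ->
     ph p = ph q -> side k p = side k q) ->
  Z.of_nat (crossings S k) <= 2 * Z.of_nat (length (filter D S)) + K.
Proof.
  intros Hnd Hrow HK Hran Hmon Hside. unfold crossings.
  set (L := filter _ (list_prod S S)).
  assert (HL : forall p q, In (p, q) L -> In p S /\ In q S /\
    snd p < snd q /\ (forall r, In r S -> snd r <= snd p \/ snd q <= snd r) /\
    side k p <> side k q).
  { intros p q H. apply filter_In in H. simpl in H. destruct H as [H1 H2].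
    apply in_prod_iff in H1. apply andb_true_iff in H2. destruct H2 as [H2 H3].
    apply consecutive_spec in H2. destruct H1, H2. repeat split; trivial.
    intros e. rewrite e, xorb_nilpotent in H3. discriminate. }
  (* Each crossing is charged to an endpoint in [D], tagged as lower or upper, or else to the phase
     of its lower endpoint. The phase then rises strictly, so [K] itself is never charged. *)
  pose (code := fun pq : point * point =>
    if D (fst pq) then inl (inl (fst pq))
    else if D (snd pq) then inl (inr (snd pq)) else inr (ph (fst pq))
    : (point + point) + Z).
  assert (Hph : forall p q, In (p, q) L -> D p = false -> D q = false -> ph p < ph q).
  { intros p q H Dp Dq. destruct (HL _ _ H) as (Hp & Hq & Hlt & _ & Hs).
    specialize (Hmon p q Hp Hq Dp Dq Hlt).
    destruct (Z.eq_dec (ph p) (ph q)) as [E|]; [|lia].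
    now elim Hs; apply Hside. }
  assert (Hnd' : NoDup (map code L)).
  { apply Injective_map_NoDup_in; [|apply NoDup_filter, NoDup_list_prod; assumption].
    intros [p q] [p' q'] H H' E. unfold code in E; simpl in E.
    pose proof (Hph p q H) as F. pose proof (Hph p' q' H') as F'.
    destruct (HL _ _ H) as (Hp & Hq & Hlt & Hc & _).
    destruct (HL _ _ H') as (Hp' & Hq' & Hlt' & Hc' & _).
    assert (Hpp : snd p = snd p' \/ snd q = snd q' ->
                  (p, q) = (p', q')).
    { intros Heq. f_equal; apply Hrow; trivial;
      pose proof (Hc p' Hp'); pose proof (Hc' p Hp);
      pose proof (Hc q' Hq'); pose proof (Hc' q Hq); lia. }
    destruct (D p) eqn:Dp, (D p') eqn:Dp', (D q) eqn:Dq, (D q') eqn:Dq';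
      try discriminate; injection E as E;
      try (apply Hpp; rewrite E; tauto).
    apply Hpp. left.
    specialize (F eq_refl eq_refl). specialize (F' eq_refl eq_refl).
    (* Of two different consecutive pairs, the lower one ends no later than the upper one starts; by
       then the phase has already risen. *)
    destruct (Z.lt_trichotomy (snd p) (snd p')) as [G|[G|G]]; [|exact G|]; exfalso.
    - assert (G' : ph q <= ph p').
      { destruct (Hc p' Hp') as [|G']; [lia|].
        destruct (Z.eq_dec (snd q) (snd p')) as [e|]; [|apply Hmon; trivial; lia].
        rewrite (Hrow q p' Hq Hp' e). lia. }
      lia.
    - assert (G' : ph q' <= ph p).
      { destruct (Hc' p Hp) as [|G']; [lia|].
        destruct (Z.eq_dec (snd q') (snd p)) as [e|]; [|apply Hmon; trivial; lia].
        rewrite (Hrow q' p Hq' Hp e). lia. }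
      lia. }
  set (T := map (fun p => inl (inl p)) (filter D S) ++
            map (fun p => inl (inr p)) (filter D S) ++
            map (fun i => inr (Z.of_nat i)) (seq 0 (Z.to_nat K))
            : list ((point + point) + Z)).
  assert (Hincl : incl (map code L) T).
  { intros y Hy. apply in_map_iff in Hy. destruct Hy as [[p q] [<- H]].
    pose proof (Hph p q H) as F.
    destruct (HL _ _ H) as (Hp & Hq & _).
    unfold code, T; simpl. rewrite !in_app_iff.
    destruct (D p) eqn:Dp; [|destruct (D q) eqn:Dq].
    - left. apply (in_map (fun p => inl (inl p))). now apply filter_In.
    - right; left. apply (in_map (fun p => inl (inr p))). now apply filter_In.
    - right; right. specialize (F eq_refl eq_refl).
      pose proof (Hran p Hp Dp). pose proof (Hran q Hq Dq).
      apply in_map_iff. exists (Z.to_nat (ph p)). split; [f_equal; lia|].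
      apply in_seq. lia. }
  pose proof (NoDup_incl_length Hnd' Hincl) as Hlen.
  unfold T in Hlen. rewrite !length_app, !length_map, length_seq in Hlen. lia.
Qed.

(** * Potential functions along a partitioning tree *)

(** The cost of the subtree rooted at the strip [[a, b)], without building a tree. Line [k] leaves
    columns of the strip on both sides exactly when [a <= k < b - 1]; other lines cost nothing here
    but still enter [P]. *)
Fixpoint WB_between (X : list point) (a b : Z) (P sigma : list Z) : nat :=
  match sigma with
  | [] => 0%nat
  | k :: s => Nat.add (if (a <=? k) && (k <? b - 1) then cost X P k else 0%nat)
                      (WB_between X a b (k :: P) s)
  end.

(** Line [c] is the only cut of [[a, b)] that is a cut of neither part, and it has already been
    processed. *)
Lemma WB_between_split (X : list point) (a b c : Z) (P sigma : list Z) :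
  ~ In c sigma -> a <= c < b - 1 ->
  WB_between X a b P sigma =
  (WB_between X a (c + 1) P sigma + WB_between X (c + 1) b P sigma)%nat.
Proof.
  revert P. induction sigma as [|k s IH]; intros P Hc Hab; simpl; [reflexivity|].
  simpl in Hc. rewrite IH; [|tauto|assumption].
  destruct (Z.leb_spec a k), (Z.ltb_spec k (b - 1)), (Z.ltb_spec k (c + 1 - 1)),
    (Z.leb_spec (c + 1) k); simpl; try lia; exfalso; apply Hc; left; lia.
Qed.

Lemma WB_aux_between (X : list point) (a b : Z) (P sigma : list Z) :
  (forall k, In k sigma -> a <= k < b - 1) ->
  WB_aux X P sigma = WB_between X a b P sigma.
Proof.
  revert P. induction sigma as [|k s IH]; intros P H; simpl; [reflexivity|].
  pose proof (H k (or_introl eq_refl)).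
  rewrite IH by (intros; apply H; now right).
  destruct (Z.leb_spec a k), (Z.ltb_spec k (b - 1)); simpl; lia.
Qed.

(** Telescoping: each line is paid by the potential released when its strip is split. The final
    disjunctions say that each border of [[a, b)] is an earlier line or bounds the whole set. The
    factor [m] keeps the potential integral. *)
Lemma WB_between_le (X : list point) (m : Z) (Phi : Z -> Z) :
  Phi 1 >= 0 ->
  (forall w1 w2, 1 <= w1 -> 1 <= w2 -> Phi w1 + Phi w2 <= Phi (w1 + w2)) ->
  (forall P k a b, a <= k < b - 1 ->
     (forall p, In p (strip X P k) -> a <= fst p < b) ->
     m * Z.of_nat (cost X P k) <=
     Phi (b - a) - Phi (k + 1 - a) - Phi (b - (k + 1))) ->
  forall sigma P a b, NoDup sigma -> a < b ->
  (In (a - 1) P \/ forall p, In p X -> a <= fst p) ->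
  (In (b - 1) P \/ forall p, In p X -> fst p < b) ->
  m * Z.of_nat (WB_between X a b P sigma) <= Phi (b - a).
Proof.
  intros Phi1 Hsup Hcost.
  assert (Hpos : forall w, 1 <= w -> 0 <= Phi w).
  { apply Zlt_lower_bound_ind. intros w IH Hw.
    destruct (Z.eq_dec w 1) as [->|]; [lia|].
    specialize (IH (w - 1)). specialize (Hsup (w - 1) 1).
    replace (w - 1 + 1) with w in Hsup by ring. lia. }
  induction sigma as [|k s IH]; intros P a b Hnd Hab Ha Hb.
  - simpl. specialize (Hpos (b - a)). lia.
  - inversion Hnd as [|? ? Hk Hs]; subst. simpl.
    assert (Ha' : In (a - 1) (k :: P) \/ forall p, In p X -> a <= fst p)
      by (destruct Ha; [left; now right|now right]).
    assert (Hb' : In (b - 1) (k :: P) \/ forall p, In p X -> fst p < b)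
      by (destruct Hb; [left; now right|now right]).
    destruct (Z.leb_spec a k); simpl; [|now apply IH].
    destruct (Z.ltb_spec k (b - 1)); simpl; [|now apply IH].
    rewrite (WB_between_split X a b k) by (assumption || lia).
    assert (Hc : In (k + 1 - 1) (k :: P)) by (left; lia).
    pose proof (IH (k :: P) a (k + 1) Hs ltac:(lia) Ha' (or_introl Hc)).
    pose proof (IH (k :: P) (k + 1) b Hs ltac:(lia) (or_introl Hc) Hb').
    assert (m * Z.of_nat (cost X P k) <=
            Phi (b - a) - Phi (k + 1 - a) - Phi (b - (k + 1))); [|lia].
    apply Hcost; [lia|]. intros p Hp. apply filter_In in Hp.
    destruct Hp as [HpX Hp]. unfold in_strip in Hp. rewrite forallb_forall in Hp.
    split.
    + destruct Ha as [Ha|Ha]; [|now apply Ha].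
      specialize (Hp _ Ha). destruct (Z.ltb_spec (a - 1) k); [|lia].
      simpl in Hp. apply andb_true_iff in Hp. destruct Hp as [Hp _].
      apply Z.ltb_lt in Hp. lia.
    + destruct Hb as [Hb|Hb]; [|now apply Hb].
      specialize (Hp _ Hb). destruct (Z.ltb_spec k (b - 1)); [|lia].
      apply andb_true_iff in Hp. destruct Hp as [_ Hp]. simpl in Hp.
      apply Z.leb_le in Hp. lia.
Qed.

(** * Bit reversal and the point set *)

Fixpoint bit_reversal (l t : nat) : nat :=
  match l with
  | O => O
  | S l => (bit_reversal l (t / 2) + if Nat.odd t then 2 ^ l else 0)%nat
  end.

Lemma bit_reversal_lt (l t : nat) : (bit_reversal l t < 2 ^ l)%nat.
Proof.
  revert t. induction l as [|l IH]; intros t; cbn [bit_reversal]; [simpl; lia|].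
  rewrite Nat.pow_succ_r'. specialize (IH (t / 2)%nat). destruct (Nat.odd t); lia.
Qed.

Lemma bit_reversal_inj (l t t' : nat) :
  (t < 2 ^ l)%nat -> (t' < 2 ^ l)%nat ->
  bit_reversal l t = bit_reversal l t' -> t = t'.
Proof.
  revert t t'. induction l as [|l IH]; intros t t' Ht Ht' E; [simpl in *; lia|].
  cbn [bit_reversal] in E. rewrite Nat.pow_succ_r' in Ht, Ht'.
  pose proof (bit_reversal_lt l (t / 2)). pose proof (bit_reversal_lt l (t' / 2)).
  pose proof (Nat.div_mod_eq t 2) as D. pose proof (Nat.div_mod_eq t' 2) as D'.
  rewrite <- !Nat.bit0_mod, !Nat.bit0_odd in D, D'.
  assert (Ho : Nat.odd t = Nat.odd t')
    by (destruct (Nat.odd t), (Nat.odd t'); trivial; lia).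
  rewrite Ho in *.
  assert (t / 2 = t' / 2)%nat; [|lia].
  apply IH; destruct (Nat.odd t'); cbn [Nat.b2n] in *; lia.
Qed.

(** Together with the next lemma: even times visit the lower half of the indices and odd times the
    upper half, which is the recursion of [alternating]. *)
Lemma bit_reversal_double (l t : nat) :
  bit_reversal (S l) (2 * t) = bit_reversal l t.
Proof.
  unfold bit_reversal; fold bit_reversal.
  rewrite Nat.odd_even, Nat.mul_comm, Nat.div_mul by lia. lia.
Qed.

Lemma bit_reversal_succ_double (l t : nat) :
  bit_reversal (S l) (2 * t + 1) = (2 ^ l + bit_reversal l t)%nat.
Proof.
  unfold bit_reversal; fold bit_reversal.
  rewrite Nat.odd_odd, <- (Nat.div_unique (2 * t + 1) 2 t 1) by lia. lia.
Qed.

(* In block [r] (rows [2^l r, ..., 2^l (r+1) - 1]) the point at time [t] carries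
   the index [i], the bit reversal of [t], and sits at distance about [2^l 2^i]
   to the right of the shift [2^l r].  The summand [i] makes the columns
   distinct: modulo [2^l] the abscissa is [i]. *)
Definition grid_point (l t r : nat) : point :=
  let i := Z.of_nat (bit_reversal l t) in
  (2 ^ Z.of_nat l * (Z.of_nat r + 2 ^ i) + i,
   2 ^ Z.of_nat l * Z.of_nat r + Z.of_nat t).

Definition shifted_brs (l : nat) : list point :=
  map (fun tr => grid_point l (fst tr) (snd tr))
      (list_prod (seq 0 (2 ^ l)) (seq 0 (2 ^ 2 ^ l))).

(** These read the parameters of a grid point off its coordinates: the row gives [m r], the column
    modulo [m] gives [i]. The crossing bounds for narrow and wide strips see the shape of the set
    only through [on_grid]. *)
Definition shift (m : Z) (p : point) : Z := m * (snd p / m).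
Definition index (m : Z) (p : point) : Z := fst p mod m.
Definition on_grid (m : Z) (p : point) : Prop :=
  fst p = shift m p + m * 2 ^ index m p + index m p.

Lemma pow2_of_nat (n : nat) : Z.of_nat (2 ^ n) = 2 ^ Z.of_nat n.
Proof. now rewrite Nat2Z.inj_pow. Qed.

Lemma pow2_pos (l : nat) : 0 < 2 ^ Z.of_nat l.
Proof. apply Z.pow_pos_nonneg; lia. Qed.

Lemma in_shifted_brs (l : nat) (p : point) :
  In p (shifted_brs l) <->
  exists t r, (t < 2 ^ l)%nat /\ (r < 2 ^ 2 ^ l)%nat /\ p = grid_point l t r.
Proof.
  unfold shifted_brs. rewrite in_map_iff. split.
  - intros [[t r] [<- H]]. apply in_prod_iff in H. rewrite !in_seq in H.
    exists t, r. intuition lia.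
  - intros (t & r & Ht & Hr & ->). exists (t, r). split; [reflexivity|].
    apply in_prod_iff. rewrite !in_seq. lia.
Qed.

Lemma shift_grid_point (l t r : nat) :
  (t < 2 ^ l)%nat ->
  shift (2 ^ Z.of_nat l) (grid_point l t r) = 2 ^ Z.of_nat l * Z.of_nat r.
Proof.
  intros Ht. unfold shift, grid_point; simpl. pose proof (pow2_pos l).
  pose proof (pow2_of_nat l).
  rewrite Z.mul_comm, (Z.mul_comm _ (Z.of_nat r)), Z.div_add_l, Z.div_small; lia.
Qed.

Lemma index_grid_point (l t r : nat) :
  index (2 ^ Z.of_nat l) (grid_point l t r) = Z.of_nat (bit_reversal l t).
Proof.
  unfold index, grid_point; simpl. pose proof (pow2_pos l).
  pose proof (pow2_of_nat l). pose proof (bit_reversal_lt l t).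
  rewrite Z.mul_comm, Z.add_comm, Z.mod_add, Z.mod_small; lia.
Qed.

Lemma shifted_brs_on_grid (l : nat) (p : point) :
  In p (shifted_brs l) -> on_grid (2 ^ Z.of_nat l) p.
Proof.
  intros H. apply in_shifted_brs in H. destruct H as (t & r & Ht & _ & ->).
  unfold on_grid. rewrite shift_grid_point, index_grid_point by assumption.
  unfold grid_point; simpl. ring.
Qed.

Lemma shift_mono (m : Z) (p q : point) :
  0 < m -> snd p <= snd q -> shift m p <= shift m q.
Proof.
  intros Hm H. unfold shift. pose proof (Z.div_le_mono _ _ m Hm H). nia.
Qed.

Lemma grid_point_row_inj (l t r t' r' : nat) :
  (t < 2 ^ l)%nat -> (t' < 2 ^ l)%nat ->
  snd (grid_point l t r) = snd (grid_point l t' r') -> t = t' /\ r = r'.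
Proof.
  intros Ht Ht' E. pose proof (pow2_pos l).
  assert (Es : shift (2 ^ Z.of_nat l) (grid_point l t r) =
               shift (2 ^ Z.of_nat l) (grid_point l t' r')).
  { unfold shift. now rewrite E. }
  rewrite !shift_grid_point in Es by assumption. unfold grid_point in E; simpl in E.
  assert (r = r') by nia. subst. lia.
Qed.

Lemma grid_point_column_inj (l t r t' r' : nat) :
  (t < 2 ^ l)%nat -> (t' < 2 ^ l)%nat ->
  fst (grid_point l t r) = fst (grid_point l t' r') -> t = t' /\ r = r'.
Proof.
  intros Ht Ht' E. pose proof (pow2_pos l).
  assert (Ei : index (2 ^ Z.of_nat l) (grid_point l t r) =
               index (2 ^ Z.of_nat l) (grid_point l t' r')).
  { unfold index. now rewrite E. }
  rewrite !index_grid_point in Ei.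
  apply Nat2Z.inj, bit_reversal_inj in Ei; trivial. subst.
  unfold grid_point in E; simpl in E. split; [reflexivity|nia].
Qed.

Lemma shifted_brs_row_inj (l : nat) (p q : point) :
  In p (shifted_brs l) -> In q (shifted_brs l) -> snd p = snd q -> p = q.
Proof.
  rewrite !in_shifted_brs. intros (t & r & Ht & _ & ->) (t' & r' & Ht' & _ & ->) E.
  apply grid_point_row_inj in E; trivial. now destruct E; subst.
Qed.

Lemma shifted_brs_column_inj (l : nat) (p q : point) :
  In p (shifted_brs l) -> In q (shifted_brs l) -> fst p = fst q -> p = q.
Proof.
  rewrite !in_shifted_brs. intros (t & r & Ht & _ & ->) (t' & r' & Ht' & _ & ->) E.
  apply grid_point_column_inj in E; trivial. now destruct E; subst.
Qed.

Lemma shifted_brs_NoDup (l : nat) : NoDup (shifted_brs l).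
Proof.
  apply Injective_map_NoDup_in; [|apply NoDup_list_prod; apply seq_NoDup].
  intros [t r] [t' r'] H H' E. apply in_prod_iff in H, H'. rewrite !in_seq in H, H'.
  simpl in E. destruct (grid_point_row_inj l t r t' r'); try lia; try congruence.
Qed.

Lemma shifted_brs_length (l : nat) :
  length (shifted_brs l) = (2 ^ l * 2 ^ 2 ^ l)%nat.
Proof. unfold shifted_brs. now rewrite length_map, length_prod, !length_seq. Qed.

(** Indices are below [m = 2^l], so [2^i] is at most half of [2^m]. The width of the root strip is
    thus linear in the number of points. *)
Lemma shifted_brs_range (l : nat) (p : point) :
  In p (shifted_brs l) -> 0 <= fst p < 2 * Z.of_nat (length (shifted_brs l)).
Proof.
  intros H. apply in_shifted_brs in H. destruct H as (t & r & Ht & Hr & ->).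
  rewrite shifted_brs_length, Nat2Z.inj_mul. unfold grid_point; cbn [fst].
  pose proof (pow2_pos l). pose proof (bit_reversal_lt l t) as Hi.
  pose proof (pow2_of_nat l).
  pose proof (pow2_of_nat (2 ^ l)).
  pose proof (pow2_pos (bit_reversal l t)).
  assert (2 * 2 ^ Z.of_nat (bit_reversal l t) <= 2 ^ Z.of_nat (2 ^ l)).
  { rewrite <- Z.pow_succ_r by lia. apply Z.pow_le_mono_r; lia. }
  set (E := 2 ^ Z.of_nat (bit_reversal l t)) in *.
  set (M := Z.of_nat (2 ^ 2 ^ l)) in *. set (m := Z.of_nat (2 ^ l)) in *.
  replace (2 ^ Z.of_nat l) with m in *.
  assert (m * (Z.of_nat r + E + 1) <= m * (2 * M))
    by (apply Z.mul_le_mono_nonneg_l; lia).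
  assert (0 <= m * (Z.of_nat r + E)) by (apply Z.mul_nonneg_nonneg; lia).
  lia.
Qed.

(** * Crossing bounds for strips of the point set *)

(** A crossing has an endpoint on each side of the line, so once one side is charged individually a
    constant phase suffices. *)
Lemma crossings_minority (S : list point) (k : Z) (b : bool) :
  NoDup S -> (forall p q, In p S -> In q S -> snd p = snd q -> p = q) ->
  Z.of_nat (crossings S k) <=
  2 * Z.of_nat (length (filter (fun p => Bool.eqb (side k p) b) S)).
Proof.
  intros Hnd Hrow.
  pose proof (crossings_le S k (fun p => Bool.eqb (side k p) b) (fun _ => 0) 0) as H.
  rewrite Z.add_0_r in H. apply H; trivial; try lia.
  intros p q _ _ Hp Hq _. destruct (side k p), (side k q), b; easy.
Qed.

(* A strip of width at most [m] meets at most two blocks of [m] columns.  In each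
   of them abscissae decrease with time, and the right block comes second. *)
Lemma crossings_narrow (S : list point) (k m a b : Z) :
  NoDup S -> (forall p q, In p S -> In q S -> snd p = snd q -> p = q) ->
  0 < m -> b - a <= m ->
  (forall p, In p S -> on_grid m p /\ a <= fst p < b) ->
  Z.of_nat (crossings S k) <= 3.
Proof.
  intros Hnd Hrow Hm Hab HS.
  pose proof (Z.div_mod a m ltac:(lia)) as Da.
  pose proof (Z.mod_pos_bound a m Hm) as Ba.
  set (q0 := a / m) in *. set (t := a mod m) in *.
  assert (HS' : forall p, In p S -> exists r, shift m p = m * r /\
     r = snd p / m /\
     0 <= index m p < m /\ fst p = m * (fst p / m) + index m p /\
     fst p / m = r + 2 ^ index m p /\
     q0 <= fst p / m <= q0 + 1 /\ a <= fst p < b).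
  { intros p Hp. destruct (HS p Hp) as [G R]. exists (snd p / m).
    pose proof (Z.div_mod (fst p) m ltac:(lia)) as D.
    pose proof (Z.mod_pos_bound (fst p) m Hm) as B.
    fold (index m p) in D, B. unfold on_grid, shift in G.
    assert (fst p / m = snd p / m + 2 ^ index m p)
      by (apply (Z.mul_reg_l _ _ m); lia).
    assert (q0 < fst p / m + 1) by (apply (Z.mul_lt_mono_pos_l m); lia).
    assert (fst p / m < q0 + 2) by (apply (Z.mul_lt_mono_pos_l m); lia).
    repeat split; trivial; lia. }
  (* Twice the number of the column block, plus one left of the line: abscissae decrease inside a
     block, so its right side comes first. *)
  pose proof (crossings_le S k (fun _ => false)
    (fun p => 2 * (fst p / m - q0) + if side k p then 1 else 0) 3) as H.
  rewrite (proj2 (length_zero_iff_nil _)) in H.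
  2: { clear. induction S; simpl; auto. }
  change (2 * Z.of_nat 0 + 3) with 3 in H. apply H; clear H; trivial; try lia.
  - intros p Hp _. destruct (HS' p Hp) as (r & ? & ? & ? & ? & ? & ? & ?).
    destruct (side k p); lia.
  - intros p q Hp Hq _ _ Hlt.
    destruct (HS' p Hp) as (r & ? & Er & Ip & Xp & Cp & Qp & Rp).
    destruct (HS' q Hq) as (r' & ? & Er' & Iq & Xq & Cq & Qq & Rq).
    assert (r <= r') by (subst r r'; apply Z.div_le_mono; lia).
    set (cp := fst p / m) in *. set (cq := fst q / m) in *.
    assert (Hc : cp = cq \/ cp + 1 = cq \/ cq + 1 = cp) by lia.
    destruct Hc as [Hc|[Hc|Hc]].
    + assert (index m q <= index m p).
      { apply (Z.pow_le_mono_r_iff 2); lia. }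
      unfold side. destruct (Z.leb_spec (fst p) k), (Z.leb_spec (fst q) k); nia.
    + destruct (side k p), (side k q); lia.
    (* The earlier point would lie one block further right and have the larger index, hence be more
       than [m] to the right of the later one. *)
    + exfalso. assert (index m q < index m p).
      { apply (Z.pow_lt_mono_r_iff 2); lia. }
      nia.
  - intros p q Hp Hq _ _ E. destruct (side k p), (side k q); trivial; lia.
Qed.

(* Points of the strip [a, b), cut at [c], that are charged individually.  Among the
   points of small index, those with shift left of [a] and those with shift in [a, c)
   each have a sparse side, and those with shift at least [c] are all right of [c]. *)
Definition minority (a b c m : Z) (p : point) : bool :=
  (m * 2 ^ index m p <? 2 * (b - a)) &&
  (if c - a <=? b - c
   then if fst p <? c then shift m p <? a
        else (a <=? shift m p) && (shift m p <? c)
   else (c <=? fst p) && (shift m p <? c)).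

(* For indices with [m 2^i >= 2 (b - a)], the sets of shifts that put a point into
   the strip are disjoint intervals, in decreasing order of the index. *)
Lemma crossings_wide (S : list point) (m a b c : Z) :
  NoDup S -> (forall p q, In p S -> In q S -> snd p = snd q -> p = q) ->
  0 < m -> a < c < b ->
  (forall p, In p S -> on_grid m p /\ a <= fst p < b) ->
  Z.of_nat (crossings S (c - 1)) <=
  2 * Z.of_nat (length (filter (minority a b c m) S)) + (2 * m + 2).
Proof.
  intros Hnd Hrow Hm Hc HS.
  (* Large indices come first, in decreasing order, with two phases each because their points move
     right. The small indices follow with three phases, according to the position of the shift
     relative to [a] and [c]. *)
  apply crossings_le with (ph := fun p =>
    if 2 * (b - a) <=? m * 2 ^ index m p
    then 2 * (m - 1 - index m p) + (if fst p <? c then 0 else 1)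
    else if shift m p <? a then 2 * m
    else if shift m p <? c then 2 * m + 1 else 2 * m + 2); trivial; try lia.
  - intros p Hp _. pose proof (Z.mod_pos_bound (fst p) m Hm) as B.
    fold (index m p) in B.
    destruct (Z.leb_spec (2 * (b - a)) (m * 2 ^ index m p)), (Z.ltb_spec (fst p) c),
      (Z.ltb_spec (shift m p) a), (Z.ltb_spec (shift m p) c); lia.
  - intros p q Hp Hq _ _ Hlt.
    destruct (HS p Hp) as [Gp Rp]. destruct (HS q Hq) as [Gq Rq].
    unfold on_grid in Gp, Gq.
    pose proof (Z.mod_pos_bound (fst p) m Hm) as Bp. fold (index m p) in Bp.
    pose proof (Z.mod_pos_bound (fst q) m Hm) as Bq. fold (index m q) in Bq.
    pose proof (shift_mono m p q Hm ltac:(lia)) as Hs.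
    (* If the index grew to such a large [i], the later point would lie at least
       [m 2^i / 2 >= b - a] to the right of the earlier one. *)
    assert (Hfar : 2 * (b - a) <= m * 2 ^ index m q -> index m q <= index m p).
    { intros F. destruct (Z_le_gt_dec (index m q) (index m p)) as [|I]; [assumption|].
      exfalso. assert (2 * 2 ^ index m p <= 2 ^ index m q).
      { rewrite <- Z.pow_succ_r by lia. apply Z.pow_le_mono_r; lia. }
      nia. }
    destruct (Z.leb_spec (2 * (b - a)) (m * 2 ^ index m q)) as [Fq|Fq].
    + specialize (Hfar Fq).
      assert (2 ^ index m q <= 2 ^ index m p) by (apply Z.pow_le_mono_r; lia).
      destruct (Z.leb_spec (2 * (b - a)) (m * 2 ^ index m p)); [|nia].
      destruct (Z.eq_dec (index m p) (index m q)) as [e|].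
      * rewrite e in *.
        destruct (Z.ltb_spec (fst p) c), (Z.ltb_spec (fst q) c); lia.
      * destruct (fst p <? c), (fst q <? c); lia.
    + destruct (Z.leb_spec (2 * (b - a)) (m * 2 ^ index m p)), (Z.ltb_spec (fst p) c),
      (Z.ltb_spec (shift m p) a), (Z.ltb_spec (shift m p) c),
      (Z.ltb_spec (shift m q) a), (Z.ltb_spec (shift m q) c); lia.
  - intros p q Hp Hq Dp Dq.
    destruct (HS p Hp) as [Gp Rp]. destruct (HS q Hq) as [Gq Rq].
    unfold on_grid in Gp, Gq. unfold minority in Dp, Dq. unfold side.
    pose proof (Z.mod_pos_bound (fst p) m Hm) as Bp. fold (index m p) in Bp.
    pose proof (Z.mod_pos_bound (fst q) m Hm) as Bq. fold (index m q) in Bq.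
    assert (0 < m * 2 ^ index m p) by (apply Z.mul_pos_pos; [lia|apply Z.pow_pos_nonneg; lia]).
    assert (0 < m * 2 ^ index m q) by (apply Z.mul_pos_pos; [lia|apply Z.pow_pos_nonneg; lia]).
    revert Dp Dq.
    destruct (Z.leb_spec (c - a) (b - c)),
      (Z.leb_spec (2 * (b - a)) (m * 2 ^ index m p)),
      (Z.ltb_spec (m * 2 ^ index m p) (2 * (b - a))); try lia;
    destruct (Z.leb_spec (2 * (b - a)) (m * 2 ^ index m q)),
      (Z.ltb_spec (m * 2 ^ index m q) (2 * (b - a))); try lia;
    destruct (Z.ltb_spec (fst p) c), (Z.leb_spec c (fst p)); try lia;
    destruct (Z.ltb_spec (fst q) c), (Z.leb_spec c (fst q)); try lia;
    destruct (Z.leb_spec (fst p) (c - 1)), (Z.leb_spec (fst q) (c - 1)); try lia;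
    destruct (Z.ltb_spec (shift m p) a), (Z.ltb_spec (shift m p) c),
      (Z.leb_spec a (shift m p)); try lia;
    destruct (Z.ltb_spec (shift m q) a), (Z.ltb_spec (shift m q) c),
      (Z.leb_spec a (shift m q)); cbn [andb]; intros; lia || easy.
Qed.

(** * The potential and the linear bound on WB *)

Definition excess (P w : Z) : Z := Z.max 0 (4 * w - P).

Lemma excess_superadditive (P w1 w2 : Z) :
  0 < P -> 1 <= w1 -> 1 <= w2 ->
  excess P w1 + excess P w2 <= excess P (w1 + w2).
Proof. unfold excess. lia. Qed.

(** The gain is [P] if both parts have positive excess, four times the width of the other part if
    only one has, and [4 (w1 + w2) - P > P] if neither has. *)
Lemma excess_gain (P w1 w2 : Z) :
  0 < P -> 1 <= w1 -> 1 <= w2 -> P < 2 * (w1 + w2) ->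
  excess P w1 + excess P w2 + Z.min P (Z.min w1 w2) <= excess P (w1 + w2).
Proof. unfold excess. lia. Qed.

Lemma length_filter_multiples (f : nat -> bool) (n : nat) (m lo len : Z) :
  0 < m -> 0 <= len ->
  (forall r, f r = true -> lo <= m * Z.of_nat r < lo + len) ->
  m * Z.of_nat (length (filter f (seq 0 n))) <= len + m.
Proof.
  intros Hm Hlen H. apply multiples_in_interval with (lo := lo); trivial.
  - apply NoDup_filter, seq_NoDup.
  - intros r Hr. apply filter_In in Hr. now apply H.
Qed.

(** With [i] the index at time [t] and [u] the width of the narrower part, the charged shifts lie in
    at most two intervals of length [min(u, P + i)]. Each interval loses at most [m] through [i < m]
    and another [m] through rounding to multiples of [m], whence [4 m]. *)
Lemma minority_count (l t : nat) (a b c : Z) :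
  (t < 2 ^ l)%nat -> a < c < b ->
  let m := 2 ^ Z.of_nat l in
  let P := m * 2 ^ Z.of_nat (bit_reversal l t) in
  m * Z.of_nat (length (filter
    (fun r => minority a b c m (grid_point l t r) &&
              ((a <=? fst (grid_point l t r)) && (fst (grid_point l t r) <? b)))
    (seq 0 (2 ^ 2 ^ l)))) <=
  2 * (excess P (b - a) - excess P (c - a) - excess P (b - c)) + 4 * m.
Proof.
  intros Ht Hc m P.
  pose proof (pow2_pos l) as Hm. fold m in Hm.
  pose proof (pow2_pos (bit_reversal l t)) as Hi.
  pose proof (bit_reversal_lt l t) as Hil. pose proof (pow2_of_nat l) as Em.
  fold m in Em.
  assert (HP : 0 < P) by (apply Z.mul_pos_pos; lia).
  pose proof (excess_superadditive P (c - a) (b - c) HP ltac:(lia) ltac:(lia)) as Hsup.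
  replace (c - a + (b - c)) with (b - a) in Hsup by ring.
  set (i := Z.of_nat (bit_reversal l t)) in *.
  set (f := fun r => _).
  assert (Hf : forall r, f r = true ->
    P < 2 * (b - a) /\ a <= m * Z.of_nat r + P + i < b /\
    (if c - a <=? b - c
     then m * Z.of_nat r + P + i < c /\ m * Z.of_nat r < a \/
          c <= m * Z.of_nat r + P + i /\ a <= m * Z.of_nat r < c
     else c <= m * Z.of_nat r + P + i /\ m * Z.of_nat r < c)).
  { intros r. unfold f, minority.
    pose proof (index_grid_point l t r) as Ei. fold m i in Ei. rewrite Ei.
    pose proof (shift_grid_point l t r Ht) as Es. fold m in Es. rewrite Es.
    replace (fst (grid_point l t r)) with (m * Z.of_nat r + P + i)
      by (unfold grid_point, P; cbn [fst]; fold m i; ring).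
    fold P. rewrite !andb_true_iff, !Z.ltb_lt, Z.leb_le.
    destruct (c - a <=? b - c); [|rewrite andb_true_iff, Z.leb_le, Z.ltb_lt; tauto].
    destruct (Z.ltb_spec (m * Z.of_nat r + P + i) c); [rewrite Z.ltb_lt; tauto|].
    rewrite andb_true_iff, Z.leb_le, Z.ltb_lt; tauto. }
  destruct (Z_lt_ge_dec P (2 * (b - a))) as [Near|Far].
  2: { rewrite (length_filter_multiples f _ m 0 0) by
         (trivial; try lia; intros r Hr; apply Hf in Hr; lia). lia. }
  pose proof (excess_gain P (c - a) (b - c) HP ltac:(lia) ltac:(lia) ltac:(lia)) as G.
  replace (c - a + (b - c)) with (b - a) in G by ring.
  destruct (Z.leb_spec (c - a) (b - c)) as [Hw|Hw].
  - set (fl := fun r : nat => (m * Z.of_nat r + P + i <? c) && f r).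
    set (fr := fun r : nat => (c <=? m * Z.of_nat r + P + i) && f r).
    assert (Hl : m * Z.of_nat (length (filter fl (seq 0 (2 ^ 2 ^ l)))) <=
                 Z.min (c - a) (P + i) + m).
    { apply length_filter_multiples with (lo := a - P - i); [lia|lia|].
      intros r Hr. apply andb_true_iff in Hr. destruct Hr as [Hr1 Hr].
      apply Z.ltb_lt in Hr1. apply Hf in Hr. lia. }
    assert (Hr : m * Z.of_nat (length (filter fr (seq 0 (2 ^ 2 ^ l)))) <=
                 Z.min (c - a) (P + i) + m).
    { apply length_filter_multiples with (lo := Z.max a (c - P - i)); [lia|lia|].
      intros r Hr. apply andb_true_iff in Hr. destruct Hr as [Hr1 Hr].
      apply Z.leb_le in Hr1. apply Hf in Hr. lia. }
    pose proof (length_filter_orb f fl fr (seq 0 (2 ^ 2 ^ l))) as Hor.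
    assert (Hcover : forall r, In r (seq 0 (2 ^ 2 ^ l)) -> f r = true ->
                     fl r = true \/ fr r = true).
    { intros r _ E. unfold fl, fr. rewrite E, !andb_true_r, Z.ltb_lt, Z.leb_le. lia. }
    specialize (Hor Hcover).
    clear Hf Hcover. nia.
  - assert (H1 : m * Z.of_nat (length (filter f (seq 0 (2 ^ 2 ^ l)))) <=
        Z.min (b - c) (P + i) + m).
    { apply length_filter_multiples with (lo := c - P - i); [lia|lia|].
      intros r Hr. apply Hf in Hr. lia. }
    clear Hf. lia.
Qed.

(** Its drop at a split pays [m] times the cost of the line. The first term releases [3 m], for the
    three crossings of a narrow strip. In a strip wider than [m] the second releases at least
    [12 m min(m, u)], with [u] the width of the narrower part. The third is twice the doubled count
    of charged points; if [u >= m], the remaining [2 * 4 m^2 + m (2 m + 2)] is covered by the first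
    two. *)
Definition potential (l : nat) (w : Z) : Z :=
  let m := 2 ^ Z.of_nat l in
  3 * m * (w - 1) + 12 * m * excess m w +
  4 * zsum (fun t => excess (m * 2 ^ Z.of_nat (bit_reversal l t)) w) (seq 0 (2 ^ l)).

Lemma potential_gain (l : nat) (w1 w2 : Z) :
  1 <= w1 -> 1 <= w2 ->
  let m := 2 ^ Z.of_nat l in
  let gain t := excess (m * 2 ^ Z.of_nat (bit_reversal l t)) (w1 + w2)
     - excess (m * 2 ^ Z.of_nat (bit_reversal l t)) w1
     - excess (m * 2 ^ Z.of_nat (bit_reversal l t)) w2 in
  potential l (w1 + w2) - potential l w1 - potential l w2 =
  3 * m + 12 * m * (excess m (w1 + w2) - excess m w1 - excess m w2)
  + 4 * zsum gain (seq 0 (2 ^ l)) /\ 0 <= zsum gain (seq 0 (2 ^ l)).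
Proof.
  intros H1 H2 m gain. split.
  - unfold potential. fold m.
    assert (E : forall L, zsum gain L =
      zsum (fun t => excess (m * 2 ^ Z.of_nat (bit_reversal l t)) (w1 + w2)) L
      - zsum (fun t => excess (m * 2 ^ Z.of_nat (bit_reversal l t)) w1) L
      - zsum (fun t => excess (m * 2 ^ Z.of_nat (bit_reversal l t)) w2) L).
    { induction L as [|t L IH]; [reflexivity|]. cbn [zsum fold_right].
      unfold zsum in IH. rewrite IH. unfold gain. ring. }
    rewrite E. ring.
  - apply zsum_nonneg. intros t. unfold gain.
    assert (0 < m * 2 ^ Z.of_nat (bit_reversal l t))
      by (apply Z.mul_pos_pos; apply pow2_pos).
    pose proof (excess_superadditive _ w1 w2 H H1 H2). lia.
Qed.

Lemma length_filter_column_range (X : list point) (f : point -> bool) (lo hi : Z) :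
  NoDup X -> (forall p q, In p X -> In q X -> fst p = fst q -> p = q) ->
  lo <= hi -> (forall p, In p X -> f p = true -> lo <= fst p < hi) ->
  Z.of_nat (length (filter f X)) <= hi - lo.
Proof.
  intros Hnd Hcol Hle H. rewrite <- (length_map (fun p : point => fst p)).
  apply length_le_interval; trivial.
  - apply Injective_map_NoDup_in; [|now apply NoDup_filter].
    intros p q Hp Hq. apply filter_In in Hp, Hq. now apply Hcol.
  - intros x Hx. apply in_map_iff in Hx. destruct Hx as [p [<- Hp]].
    apply filter_In in Hp. now apply H.
Qed.

(** Three regimes: strips of width at most [m] use [crossings_narrow]; splits with a part narrower
    than [m] count the columns of that part; all others combine [crossings_wide] with
    [minority_count]. *)
Lemma cost_le_potential (l : nat) (P : list Z) (k a b : Z) :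
  a <= k < b - 1 ->
  (forall p, In p (strip (shifted_brs l) P k) -> a <= fst p < b) ->
  2 ^ Z.of_nat l * Z.of_nat (cost (shifted_brs l) P k) <=
  potential l (b - a) - potential l (k + 1 - a) - potential l (b - (k + 1)).
Proof.
  intros Hk HS.
  change (cost (shifted_brs l) P k) with (crossings (strip (shifted_brs l) P k) k).
  set (S := strip (shifted_brs l) P k) in *.
  assert (HX : forall p, In p S -> In p (shifted_brs l))
    by (intros p Hp; now apply filter_In in Hp).
  assert (Hnd : NoDup S) by apply NoDup_filter, shifted_brs_NoDup.
  assert (Hrow : forall p q, In p S -> In q S -> snd p = snd q -> p = q)
    by (intros p q Hp Hq; apply (shifted_brs_row_inj l); auto).
  assert (Hcol : forall p q, In p S -> In q S -> fst p = fst q -> p = q)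
    by (intros p q Hp Hq; apply (shifted_brs_column_inj l); auto).
  set (m := 2 ^ Z.of_nat l).
  assert (HG : forall p, In p S -> on_grid m p /\ a <= fst p < b)
    by (intros p Hp; split; [apply shifted_brs_on_grid|]; auto).
  pose proof (pow2_pos l) as Hm. fold m in Hm.
  pose proof (potential_gain l (k + 1 - a) (b - (k + 1)) ltac:(lia) ltac:(lia)) as Hgain.
  cbv zeta in Hgain. fold m in Hgain. destruct Hgain as [Eg Hg].
  replace (k + 1 - a + (b - (k + 1))) with (b - a) in * by ring.
  rewrite Eg. clear Eg.
  set (gains := zsum _ _) in *.
  pose proof (excess_superadditive m (k + 1 - a) (b - (k + 1)) Hm
    ltac:(lia) ltac:(lia)) as Hsup.
  replace (k + 1 - a + (b - (k + 1))) with (b - a) in Hsup by ring.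
  destruct (Z_le_gt_dec (b - a) m) as [Hw|Hw].
  { pose proof (crossings_narrow S k m a b Hnd Hrow Hm Hw HG). nia. }
  pose proof (excess_gain m (k + 1 - a) (b - (k + 1)) Hm
    ltac:(lia) ltac:(lia) ltac:(lia)) as Hmin.
  replace (k + 1 - a + (b - (k + 1))) with (b - a) in Hmin by ring.
  assert (Hside : Z.of_nat (crossings S k) <=
                  2 * Z.min (k + 1 - a) (b - (k + 1))).
  { pose proof (crossings_minority S k true Hnd Hrow) as Hl.
    pose proof (crossings_minority S k false Hnd Hrow) as Hr.
    pose proof (length_filter_column_range S (fun p => Bool.eqb (side k p) true)
      a (k + 1) Hnd Hcol ltac:(lia)) as Cl.
    pose proof (length_filter_column_range S (fun p => Bool.eqb (side k p) false)
      (k + 1) b Hnd Hcol ltac:(lia)) as Cr.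
    assert (Hs : forall p c, Bool.eqb (side k p) c = true ->
              if c then fst p <= k else k < fst p).
    { intros p c E. apply eqb_prop in E. unfold side in E.
      destruct (Z.leb_spec (fst p) k); subst c; assumption. }
    specialize (Cl ltac:(intros p Hp E; specialize (HS p Hp);
                         specialize (Hs p _ E); simpl in Hs; lia)).
    specialize (Cr ltac:(intros p Hp E; specialize (HS p Hp);
                         specialize (Hs p _ E); simpl in Hs; lia)).
    lia. }
  destruct (Z_lt_ge_dec (Z.min (k + 1 - a) (b - (k + 1))) m) as [Hu|Hu]; [nia|].
  pose proof (crossings_wide S m a b (k + 1) Hnd Hrow Hm ltac:(lia) HG) as Hwide.
  replace (k + 1 - 1) with k in Hwide by ring.
  assert (Hcount : m * Z.of_nat (length (filter (minority a b (k + 1) m) S)) <=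
                   2 * gains + 4 * m * m).
  { apply Z.le_trans with (zsum (fun t =>
      2 * (excess (m * 2 ^ Z.of_nat (bit_reversal l t)) (b - a)
           - excess (m * 2 ^ Z.of_nat (bit_reversal l t)) (k + 1 - a)
           - excess (m * 2 ^ Z.of_nat (bit_reversal l t)) (b - (k + 1)))
      + 4 * m) (seq 0 (2 ^ l))).
    (* The charged points are counted by their parameters [(t, r)], since [minority_count] fixes the
       time [t]. *)
    - apply Z.le_trans with (m * Z.of_nat (length (filter
        (fun tr => minority a b (k + 1) m (grid_point l (fst tr) (snd tr)) &&
          ((a <=? fst (grid_point l (fst tr) (snd tr))) &&
           (fst (grid_point l (fst tr) (snd tr)) <? b)))
        (list_prod (seq 0 (2 ^ l)) (seq 0 (2 ^ 2 ^ l)))))).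
      + apply Z.mul_le_mono_nonneg_l; [lia|]. apply Nat2Z.inj_le.
        erewrite <- (length_map (fun tr => grid_point l (fst tr) (snd tr))
          (filter _ (list_prod _ _))).
        apply NoDup_incl_length; [now apply NoDup_filter|].
        intros p Hp. apply filter_In in Hp. destruct Hp as [Hp Hmin'].
        pose proof (HS p Hp). apply HX, in_map_iff in Hp.
        destruct Hp as [tr [<- Htr]].
        apply in_map_iff. exists tr. split; [reflexivity|]. apply filter_In.
        rewrite Hmin', !andb_true_iff, Z.leb_le, Z.ltb_lt. tauto.
      + apply length_filter_list_prod. intros t Ht. apply in_seq in Ht.
        apply (minority_count l t a b (k + 1)); lia.
    - rewrite zsum_affine, length_seq, pow2_of_nat.
      unfold gains, m. lia. }
  nia.
Qed.

(** Each excess is at most [4 w] and there are [m] times, so [67 = 3 + 12 * 4 + 4 * 4]. *)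
Lemma potential_le (l : nat) (w : Z) :
  1 <= w -> potential l w <= 67 * 2 ^ Z.of_nat l * w.
Proof.
  intros Hw. unfold potential. pose proof (pow2_pos l) as Hm.
  set (m := 2 ^ Z.of_nat l) in *.
  assert (zsum (fun t => excess (m * 2 ^ Z.of_nat (bit_reversal l t)) w)
            (seq 0 (2 ^ l)) <= 4 * w * m).
  (* The constant is written in the shape that [zsum_affine] expects. *)
  { apply Z.le_trans with (zsum (fun _ => 0 * 0 + 4 * w) (seq 0 (2 ^ l))).
    - apply zsum_le. intros t _.
      assert (0 < m * 2 ^ Z.of_nat (bit_reversal l t))
        by (apply Z.mul_pos_pos; [exact Hm|apply pow2_pos]).
      unfold excess. lia.
    - rewrite (zsum_affine (fun _ => 0)), length_seq, pow2_of_nat.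
      fold m. lia. }
  assert (excess m w <= 4 * w) by (unfold excess; lia).
  nia.
Qed.

Lemma shifted_brs_WB (l : nat) (sigma : list Z) :
  is_ordering (shifted_brs l) sigma ->
  Z.of_nat (WB_sigma (shifted_brs l) sigma) <=
  134 * Z.of_nat (length (shifted_brs l)).
Proof.
  intros [Hnd Hord]. pose proof (pow2_pos l) as Hm.
  assert (Hn : 0 < Z.of_nat (length (shifted_brs l))).
  { rewrite shifted_brs_length, Nat2Z.inj_mul, (pow2_of_nat l),
      (pow2_of_nat (2 ^ l)).
    apply Z.mul_pos_pos; apply pow2_pos. }
  set (n := Z.of_nat (length (shifted_brs l))) in *.
  (* The root strip has width [2 n], whence [134 = 2 * 67]. *)
  unfold WB_sigma. rewrite (WB_aux_between _ 0 (2 * n)).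
  - assert (H : 2 ^ Z.of_nat l *
      Z.of_nat (WB_between (shifted_brs l) 0 (2 * n) [] sigma) <=
      potential l (2 * n - 0)).
    { apply WB_between_le; trivial; try lia.
      - unfold potential. unfold excess at 1.
        pose proof (zsum_nonneg
          (fun t => excess (2 ^ Z.of_nat l * 2 ^ Z.of_nat (bit_reversal l t)) 1)
          (seq 0 (2 ^ l)) ltac:(intros; apply Z.le_max_l)).
        nia.
      - intros w1 w2 H1 H2. pose proof (potential_gain l w1 w2 H1 H2) as [E G].
        pose proof (excess_superadditive _ w1 w2 Hm H1 H2). nia.
      - intros P k a b. apply cost_le_potential.
      - right. intros p Hp. now apply shifted_brs_range in Hp.
      - right. intros p Hp. now apply shifted_brs_range in Hp. }
    rewrite Z.sub_0_r in H.
    pose proof (potential_le l (2 * n) ltac:(lia)). nia.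
  - intros k Hk. apply Hord in Hk. destruct Hk as (p & q & Hp & Hq & Hpq).
    apply shifted_brs_range in Hp, Hq. fold n in Hp, Hq. lia.
Qed.

(** * The lower bound on opt *)

Lemma length_filter_disjoint {A : Type} (f g h : A -> bool) (l : list A) :
  (forall x, In x l -> f x = true -> g x = false /\ h x = true) ->
  (forall x, In x l -> g x = true -> h x = true) ->
  (length (filter f l) + length (filter g l) <= length (filter h l))%nat.
Proof.
  induction l as [|x l IH]; intros Hf Hg; simpl; [lia|].
  specialize (IH (fun y Hy => Hf y (or_intror Hy)) (fun y Hy => Hg y (or_intror Hy))).
  pose proof (Hf x (or_introl eq_refl)) as Fx.
  pose proof (Hg x (or_introl eq_refl)) as Gx.
  destruct (f x), (g x), (h x); simpl; try lia.
  all: destruct (Fx eq_refl); discriminate.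
Qed.

Lemma exists_rightmost (L : list point) (z0 : point) :
  In z0 L -> exists z, In z L /\ forall z', In z' L -> fst z' <= fst z.
Proof.
  revert z0. induction L as [|z L IH]; intros z0 H; [easy|].
  destruct L as [|w L].
  - exists z. split; [now left|]. intros z' [<-|[]]. lia.
  - destruct (IH w (or_introl eq_refl)) as (y & Hy & Hmax).
    destruct (Z_le_gt_dec (fst z) (fst y)).
    + exists y. split; [now right|]. intros z' [<-|H']; auto.
    + exists z. split; [now left|]. intros z' [<-|H']; [lia|].
      specialize (Hmax z' H'). lia.
Qed.

Lemma length_ge_disjoint_rows (n : nat) (lo hi : nat -> Z) (L : list point) :
  (forall t, (t < n)%nat -> exists z, In z L /\ lo t <= snd z <= hi t) ->
  (forall t t', (t < t' < n)%nat -> hi t < lo t') ->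
  (n <= length L)%nat.
Proof.
  revert L. induction n as [|n IH]; intros L H Hlt; [lia|].
  destruct (H n ltac:(lia)) as (z & Hz & Rz).
  apply in_split in Hz. destruct Hz as (L1 & L2 & ->).
  assert (n <= length (L1 ++ L2))%nat.
  { apply IH; [|intros t t' Ht; apply Hlt; lia].
    intros t Ht. destruct (H t ltac:(lia)) as (y & Hy & Ry).
    exists y. split; [|exact Ry]. apply in_elt_inv in Hy.
    destruct Hy as [<-|Hy]; [|exact Hy].
    specialize (Hlt t n ltac:(lia)). lia. }
  rewrite length_app in *. simpl. lia.
Qed.

(** Induction on the half-perimeter of the box: a third point in the box replaces the endpoint on
    its own side of [c], until both endpoints share a row. *)
Lemma satisfied_row_crossing (S : list point) (c : Z) :
  satisfied S -> forall p q, In p S -> In q S -> fst p < c <= fst q ->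
  exists z z', In z S /\ In z' S /\ snd z = snd z' /\
    fst p <= fst z < c /\ c <= fst z' <= fst q /\
    Z.min (snd p) (snd q) <= snd z <= Z.max (snd p) (snd q).
Proof.
  intros HS.
  assert (H : forall n p q, In p S -> In q S -> fst p < c <= fst q ->
    fst q - fst p + Z.abs (snd q - snd p) < Z.of_nat n ->
    exists z z', In z S /\ In z' S /\ snd z = snd z' /\
      fst p <= fst z < c /\ c <= fst z' <= fst q /\
      Z.min (snd p) (snd q) <= snd z <= Z.max (snd p) (snd q)).
  { induction n as [|n IH]; intros p q Hp Hq Hc Hn; [lia|].
    destruct (Z.eq_dec (snd p) (snd q)) as [E|E].
    { exists p, q. repeat split; trivial; lia. }
    destruct (HS p q Hp Hq) as (r & Hr & Hrp & Hrq & Hx & Hy);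
      [intros [?|?]; lia|].
    assert (Hrp' : fst r <> fst p \/ snd r <> snd p).
    { destruct (Z.eq_dec (fst r) (fst p)); [|now left].
      right. intros e'. apply Hrp. destruct r, p; simpl in *; congruence. }
    assert (Hrq' : fst r <> fst q \/ snd r <> snd q).
    { destruct (Z.eq_dec (fst r) (fst q)); [|now left].
      right. intros e'. apply Hrq. destruct r, q; simpl in *; congruence. }
    destruct (Z_lt_ge_dec (fst r) c).
    - destruct (IH r q Hr Hq ltac:(lia) ltac:(lia)) as (z & z' & H).
      exists z, z'. intuition lia.
    - destruct (IH p r Hp Hr ltac:(lia) ltac:(lia)) as (z & z' & H).
      exists z, z'. intuition lia. }
  intros p q Hp Hq Hc.
  apply (H (Z.to_nat (fst q - fst p + Z.abs (snd q - snd p) + 1))); trivial; lia.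
Qed.

(* The abscissae [x 0, ..., x (2^l - 1)] alternate between the two halves of
   [a, b), and so do recursively the subsequences inside each half. *)
Fixpoint alternating (l : nat) (a b : Z) (x : nat -> Z) : Prop :=
  match l with
  | O => a <= x 0%nat < b
  | S l => exists c, alternating l a c (fun t => x (2 * t)%nat) /\
                     alternating l c b (fun t => x (2 * t + 1)%nat)
  end.

Lemma alternating_ext (l : nat) (a b : Z) (x x' : nat -> Z) :
  (forall t, x t = x' t) -> alternating l a b x -> alternating l a b x'.
Proof.
  revert a b x x'. induction l as [|l IH]; intros a b x x' E; simpl.
  - now rewrite E.
  - intros (c & H1 & H2). exists c.
    split; [revert H1|revert H2]; apply IH; intros; apply E.
Qed.

Lemma alternating_range (l : nat) (a b : Z) (x : nat -> Z) :
  alternating l a b x -> forall t, (t < 2 ^ l)%nat -> a <= x t < b.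
Proof.
  revert a b x. induction l as [|l IH]; intros a b x H t Ht.
  - simpl in Ht. now replace t with 0%nat by lia.
  - rewrite Nat.pow_succ_r' in Ht. destruct H as (c & H1 & H2).
    (* Time 0 of each half shows [a < c < b]. *)
    pose proof (IH _ _ _ H1 0%nat ltac:(lia)).
    pose proof (IH _ _ _ H2 0%nat ltac:(lia)).
    destruct (Nat.Even_or_Odd t) as [[s ->]|[s ->]].
    + specialize (IH _ _ _ H1 s ltac:(lia)). simpl in *. lia.
    + specialize (IH _ _ _ H2 s ltac:(lia)). simpl in *. lia.
Qed.

(** The offset [o] serves the induction: the odd times run through the indices from [o + 2^l] on. *)
Lemma alternating_bit_reversal (l o : nat) (g : nat -> Z) :
  (forall i j, (i < j)%nat -> g i < g j) ->
  alternating l (g o) (g (o + 2 ^ l)%nat) (fun t => g (o + bit_reversal l t)%nat).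
Proof.
  intros Hg. revert o. induction l as [|l IH]; intros o.
  - simpl. rewrite Nat.add_0_r. specialize (Hg o (o + 1)%nat ltac:(lia)). lia.
  - exists (g (o + 2 ^ l)%nat). split.
    + eapply alternating_ext; [|apply IH].
      intros t. cbv beta. now rewrite bit_reversal_double.
    + replace (o + 2 ^ S l)%nat with (o + 2 ^ l + 2 ^ l)%nat
        by (rewrite Nat.pow_succ_r'; lia).
      eapply alternating_ext; [|apply IH].
      intros t. cbv beta. rewrite bit_reversal_succ_double. f_equal. lia.
Qed.

Definition row_mate (S : list point) (lo hi : Z) (z : point) : bool :=
  existsb (fun z' => (snd z =? snd z') && ((lo <=? fst z') && (fst z' <? hi))) S.

Lemma row_mate_spec (S : list point) (lo hi : Z) (z : point) :
  row_mate S lo hi z = true <->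
  exists z', In z' S /\ snd z = snd z' /\ lo <= fst z' < hi.
Proof.
  unfold row_mate. rewrite existsb_exists. split; intros (z' & H1 & H2);
    exists z'; split; trivial; revert H2;
    rewrite !andb_true_iff, Z.eqb_eq, Z.leb_le, Z.ltb_lt; tauto.
Qed.

(** In each row, all points in the strip but the rightmost; this count measures how often rows meet
    both halves over all levels of the subdivision. *)
Definition continued (S : list point) (a b : Z) (z : point) : bool :=
  (a <=? fst z) && ((fst z <? b) && row_mate S (fst z + 1) b z).

Lemma continued_spec (S : list point) (a b : Z) (z : point) :
  continued S a b z = true <->
  a <= fst z < b /\ row_mate S (fst z + 1) b z = true.
Proof.
  unfold continued. rewrite !andb_true_iff, Z.leb_le, Z.ltb_lt. tauto.
Qed.

(* Besides the points continued inside one half, a row meeting both halves has its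
   last point of the left half continued in the whole strip. *)
Lemma alternating_continued (S : list point) (l : nat) :
  satisfied S -> forall (a b : Z) (q : nat -> point),
  (forall t, (t < 2 ^ l)%nat -> In (q t) S) ->
  (forall t t', (t < t' < 2 ^ l)%nat -> snd (q t) < snd (q t')) ->
  alternating l a b (fun t => fst (q t)) ->
  (l * 2 ^ l <= 2 * length (filter (continued S a b) S))%nat.
Proof.
  intros HS. induction l as [|l IH]; intros a b q Hin Hinc Halt; [simpl; lia|].
  destruct Halt as (c & Hl & Hr). rewrite Nat.pow_succ_r' in *.
  pose proof (IH a c (fun t => q (2 * t)%nat) ltac:(intros; apply Hin; lia)
    ltac:(intros; apply Hinc; lia) Hl) as IHl.
  pose proof (IH c b (fun t => q (2 * t + 1)%nat) ltac:(intros; apply Hin; lia)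
    ltac:(intros; apply Hinc; lia) Hr) as IHr.
  clear IH.
  pose proof (alternating_range _ _ _ _ Hl) as Rl.
  pose proof (alternating_range _ _ _ _ Hr) as Rr. cbv beta in Rl, Rr.
  assert (Hpos : (0 < 2 ^ l)%nat) by (apply Nat.neq_0_lt_0, Nat.pow_nonzero; lia).
  assert (Hac : a < c) by (specialize (Rl 0%nat); lia).
  assert (Hcb : c < b) by (specialize (Rr 0%nat); lia).
  set (across := fun z : point => (a <=? fst z) && ((fst z <? c) &&
    (negb (row_mate S (fst z + 1) c z) && row_mate S c b z))).
  assert (Hacross : forall z, across z = true <-> a <= fst z < c /\
    row_mate S (fst z + 1) c z = false /\ row_mate S c b z = true).
  { intros z. unfold across.
    rewrite !andb_true_iff, Z.leb_le, Z.ltb_lt, negb_true_iff. tauto. }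
  (* Times [2 t] and [2 t + 1] lie in different halves, and the row ranges of these pairs are
     disjoint, so each pair yields its own row meeting both halves. *)
  assert (Hnew : (2 ^ l <= length (filter across S))%nat).
  { apply length_ge_disjoint_rows with
      (lo := fun t => snd (q (2 * t)%nat)) (hi := fun t => snd (q (2 * t + 1)%nat)).
    - intros t Ht. specialize (Rl t Ht). specialize (Rr t Ht).
      destruct (satisfied_row_crossing S c HS (q (2 * t)%nat) (q (2 * t + 1)%nat))
        as (z & z' & Hz & Hz' & E & Xz & Xz' & Y); [apply Hin; lia..|lia|].
      specialize (Hinc (2 * t)%nat (2 * t + 1)%nat ltac:(lia)).
      (* The last point of this row before [c] is continued in the whole strip but not in the left
         half. *)
      destruct (exists_rightmost (filter (fun y => (snd y =? snd z) && (fst y <? c)) S) z)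
        as (y & Hy & Hmax).
      { apply filter_In. split; [exact Hz|].
        rewrite andb_true_iff, Z.eqb_eq, Z.ltb_lt. lia. }
      assert (Hzy : fst z <= fst y).
      { apply Hmax, filter_In. split; [exact Hz|].
        rewrite andb_true_iff, Z.eqb_eq, Z.ltb_lt. lia. }
      apply filter_In in Hy. rewrite andb_true_iff, Z.eqb_eq, Z.ltb_lt in Hy.
      destruct Hy as (Hy & Ey & Xy).
      exists y. split; [|lia]. apply filter_In. split; [exact Hy|].
      apply Hacross. split; [lia|]. split.
      + apply not_true_iff_false. rewrite row_mate_spec. intros (w & Hw & Ew & Xw).
        specialize (Hmax w). rewrite filter_In, andb_true_iff, Z.eqb_eq, Z.ltb_lt in Hmax.
        specialize (Hmax ltac:(intuition lia)). lia.
      + apply row_mate_spec. exists z'. repeat split; trivial; lia.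
    - intros t t' Ht. apply Hinc. lia. }
  assert (Hmono : forall z lo lo' hi hi', lo' <= lo -> hi <= hi' ->
    row_mate S lo hi z = true -> row_mate S lo' hi' z = true).
  { intros z lo lo' hi hi' H1 H2. rewrite !row_mate_spec.
    intros (w & Hw & Ew & Xw). exists w. repeat split; trivial; lia. }
  pose proof (length_filter_disjoint (continued S a c) across
    (fun z => continued S a b z && (fst z <? c)) S) as Hleft.
  pose proof (length_filter_disjoint (fun z => continued S a b z && (fst z <? c))
    (continued S c b) (continued S a b) S) as Hall.
  specialize (Hleft ltac:(
    intros z _; rewrite continued_spec; intros (Xz & Mz); split;
    [apply not_true_iff_false; rewrite Hacross; intros (_ & Mz' & _); congruence
    |rewrite andb_true_iff, Z.ltb_lt, continued_spec; repeat split; try lia;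
     revert Mz; apply Hmono; lia])).
  specialize (Hleft ltac:(
    intros z _; rewrite Hacross; intros (Xz & _ & Mz);
    rewrite andb_true_iff, Z.ltb_lt, continued_spec; repeat split; try lia;
    revert Mz; apply Hmono; lia)).
  specialize (Hall ltac:(
    intros z _; rewrite andb_true_iff, Z.ltb_lt; intros (Cz & Xz); split;
    [apply not_true_iff_false; rewrite continued_spec; lia|exact Cz])).
  specialize (Hall ltac:(
    intros z _; rewrite !continued_spec; intros (Xz & Mz); split; [lia|exact Mz])).
  replace (Datatypes.S l * (2 * 2 ^ l))%nat with (2 * (l * 2 ^ l) + 2 * 2 ^ l)%nat by ring.
  lia.
Qed.

(** The box of two points of a horizontal slab stays inside the slab, so the blocks can be treated
    separately. *)
Lemma satisfied_rows (S : list point) (lo hi : Z) :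
  satisfied S ->
  satisfied (filter (fun p => (lo <=? snd p) && (snd p <? hi)) S).
Proof.
  intros HS p q Hp Hq Hpq. apply filter_In in Hp, Hq.
  rewrite andb_true_iff, Z.leb_le, Z.ltb_lt in Hp, Hq.
  destruct (HS p q) as (r & Hr & H1 & H2 & H3); try tauto.
  exists r. repeat split; trivial; try apply H3.
  apply filter_In. split; [exact Hr|].
  rewrite andb_true_iff, Z.leb_le, Z.ltb_lt. destruct H3. lia.
Qed.

Lemma length_ge_row_blocks (S : list point) (m : Z) (K n : nat) :
  0 <= m ->
  (forall r, (r < n)%nat -> (K <= 2 * length (filter (fun p =>
     (m * Z.of_nat r <=? snd p)%Z && (snd p <? m * Z.of_nat r + m)%Z) S))%nat) ->
  (n * K <= 2 * length (filter (fun p => (snd p <? m * Z.of_nat n)%Z) S))%nat.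
Proof.
  intros Hm. induction n as [|n IH]; intros H; [lia|].
  specialize (IH ltac:(intros; apply H; lia)). specialize (H n ltac:(lia)).
  pose proof (length_filter_disjoint (fun p => (snd p <? m * Z.of_nat n)%Z)
    (fun p => (m * Z.of_nat n <=? snd p)%Z && (snd p <? m * Z.of_nat n + m)%Z)
    (fun p => (snd p <? m * Z.of_nat (Datatypes.S n))%Z) S) as Hd.
  rewrite Nat2Z.inj_succ, Z.mul_succ_r in *.
  specialize (Hd ltac:(intros p _; rewrite !Z.ltb_lt, andb_false_iff, Z.leb_gt; lia)).
  specialize (Hd ltac:(intros p _; rewrite andb_true_iff, !Z.ltb_lt, Z.leb_le; lia)).
  lia.
Qed.

Lemma shifted_brs_opt (l : nat) (Y : list point) :
  satisfied (shifted_brs l ++ Y) ->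
  (l * length (shifted_brs l) <= 2 * (length (shifted_brs l) + length Y))%nat.
Proof.
  intros HS.
  pose proof (pow2_pos l) as Hm. pose proof (pow2_of_nat l) as Em.
  set (m := 2 ^ Z.of_nat l) in *.
  pose proof (length_ge_row_blocks (shifted_brs l ++ Y) m (l * 2 ^ l) (2 ^ 2 ^ l)
    ltac:(lia)) as H.
  pose proof (filter_length_le (fun p => snd p <? m * Z.of_nat (2 ^ 2 ^ l))
    (shifted_brs l ++ Y)) as Hle.
  rewrite length_app in Hle.
  rewrite shifted_brs_length in *.
  assert (2 ^ 2 ^ l * (l * 2 ^ l) <= 2 * (2 ^ l * 2 ^ 2 ^ l + length Y))%nat; [|nia].
  eapply Nat.le_trans; [apply H|lia]. clear H Hle.
  intros r Hr.
  pose proof (satisfied_rows _ (m * Z.of_nat r) (m * Z.of_nat r + m) HS) as HSr.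
  set (Sr := filter _ _) in *.
  (* The column of index [i] in block [r]. The value at [2^l] serves as the excluded right end of
     the strip. *)
  set (x := fun i : nat => m * (Z.of_nat r + 2 ^ Z.of_nat i) + Z.of_nat i).
  eapply Nat.le_trans.
  - apply (alternating_continued Sr l HSr (x 0%nat) (x (0 + 2 ^ l)%nat)
      (fun t => grid_point l t r)).
    + intros t Ht. apply filter_In. split.
      * apply in_or_app. left. apply in_shifted_brs. now exists t, r.
      * unfold grid_point; cbn [snd]. fold m.
        rewrite andb_true_iff, Z.leb_le, Z.ltb_lt. lia.
    + intros t t' Ht. unfold grid_point; cbn [snd]. lia.
    + apply (alternating_bit_reversal l 0 x). intros i j Hij. unfold x.
      assert (2 ^ Z.of_nat i < 2 ^ Z.of_nat j) by (apply Z.pow_lt_mono_r; lia).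
      nia.
  - apply Nat.mul_le_mono_l. apply filter_length_le.
Qed.

(** * Iterated logarithms and the theorem *)

Lemma ln_mono (x y : R) : (0 < x)%R -> (x <= y)%R -> (ln x <= ln y)%R.
Proof.
  intros Hx [Hxy| ->]; [|apply Rle_refl]. now apply Rlt_le, ln_increasing.
Qed.

(** [ln n = (l + 2^l) ln 2] lies between [2^(l-1)] and [2^(l+1)]. The bound [7] gives
    [ln (ln n) >= (l - 1) ln 2 > 3 >= e]. *)
Lemma shifted_brs_lnln (l : nat) :
  (7 <= l)%nat ->
  let n := INR (length (shifted_brs l)) in
  (ln (ln n) <= INR l + 1)%R /\ (1 <= ln (ln (ln n)))%R.
Proof.
  intros Hl n.
  assert (Hl7 : (7 <= INR l)%R) by (apply le_INR in Hl; simpl in Hl; lra).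
  assert (Hm : (1 + INR l <= 2 ^ l)%R).
  { pose proof (poly l 1 ltac:(lra)) as Hp. rewrite Rmult_1_r in Hp. exact Hp. }
  assert (Hln2 : (/ 2 < ln 2 <= 1)%R).
  { split; [exact ln_lt_2|]. rewrite <- (ln_exp 1).
    apply ln_mono; [lra|]. pose proof (exp_ineq1 1 ltac:(lra)). lra. }
  assert (Ln : ln n = ((INR l + 2 ^ l) * ln 2)%R).
  { unfold n. rewrite shifted_brs_length, mult_INR, !pow_INR.
    replace (INR 2) with 2%R by (simpl; lra).
    rewrite ln_mult, !ln_pow, pow_INR by (try apply pow_lt; lra).
    replace (INR 2) with 2%R by (simpl; lra). ring. }
  assert (Hup : (ln n <= 2 ^ Datatypes.S l)%R) by (rewrite Ln; simpl; nra).
  assert (Hlo : (2 ^ (l - 1) <= ln n)%R).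
  { replace l with (Datatypes.S (l - 1)) in Ln at 2 by lia. simpl in Ln.
    pose proof (pow_lt 2 (l - 1) ltac:(lra)). rewrite Ln. nra. }
  pose proof (pow_lt 2 (l - 1) ltac:(lra)) as Hpos.
  split.
  - eapply Rle_trans; [apply ln_mono, Hup; lra|].
    rewrite ln_pow, S_INR by lra. nra.
  - apply ln_mono in Hlo; [|exact Hpos].
    rewrite ln_pow, minus_INR in Hlo by (lra || lia). simpl (INR 1) in Hlo.
    rewrite <- (ln_exp 1) at 1. pose proof exp_le_3.
    apply ln_mono; [apply exp_pos|]. nra.
Qed.

Theorem theorem1p1 :
  exists c1 c2 : R, (0 < c1)%R /\ (0 < c2)%R /\
  forall n' : nat, exists (n : nat) (X : list point),
    (n' <= n)%nat /\ NoDup X /\ length X = n /\ is_permutation X /\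
    opt_at_least X (c1 * INR n * ln (ln (INR n)))%R /\
    (forall sigma : list Z, is_ordering X sigma ->
       (INR (WB_sigma X sigma) <= c2 * INR n * ln (ln (ln (INR n))))%R).
Proof.
  (* [|Y| >= (l / 2 - 1) n] is at least [(l + 1) n / 8] for [l >= 3], and [ln (ln n) <= l + 1]. As
     [ln (ln (ln n)) >= 1], the linear bound [134 n] gives the second constant. *)
  exists (/ 8)%R, 134%R. split; [lra|]. split; [lra|].
  intros n'. set (l := Nat.max 7 n').
  assert (Hl : (7 <= l)%nat) by lia.
  destruct (shifted_brs_lnln l Hl) as [Hup Hlo].
  assert (Hl7 : (7 <= INR l)%R) by (apply le_INR in Hl; simpl in Hl; lra).
  exists (length (shifted_brs l)), (shifted_brs l).
  pose proof (pos_INR (length (shifted_brs l))) as Hn.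
  split; [|split; [|split; [|split; [|split]]]].
  - rewrite shifted_brs_length.
    pose proof (Nat.pow_gt_lin_r 2 l ltac:(lia)).
    pose proof (Nat.pow_nonzero 2 (2 ^ l) ltac:(lia)).
    apply Nat.le_trans with (2 ^ l)%nat; [lia|nia].
  - apply shifted_brs_NoDup.
  - reflexivity.
  - split; [exact (shifted_brs_row_inj l)|exact (shifted_brs_column_inj l)].
  - intros Y _ HS. apply shifted_brs_opt, le_INR in HS.
    rewrite mult_INR, mult_INR, plus_INR in HS. simpl (INR 2) in HS. nra.
  - intros sigma Hsigma. apply shifted_brs_WB in Hsigma.
    apply IZR_le in Hsigma. rewrite mult_IZR, <- !INR_IZR_INZ in Hsigma. nra.
Qed.
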